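(* In the setting described in the context (a nonconvex standard polygonal escape minimizer $\gamma$ of length $L<D$, with its selected gap placed on $y=0$ and with the line $x=Ay$ supporting its hull), there is a point $D_0$ of the path $\gamma$ (not necessarily a support point) satisfying $$D_0=(1-b\,y_D,\;y_D),\qquad 0\le y_D\le h.$$
   Context: Put $\rho=\frac{301804}{625565}$, $A=\frac{547947}{301804}$, $b=\frac{197}{766}$, $D=\frac{82074390584}{84861020075}$, and let $\Delta=\{(x,y): y\ge0,\ x\ge Ay,\ x+by\le1\}$, a triangle (with $A+b=1/\rho$) congruent to $\operatorname{conv}\{(-c,0),(c,0),(0,s)\}$, $s=766/\sqrt{625565}$, $c=197/\sqrt{625565}$. A path is an escape path if no translated and rotated copy of it lies in the interior of $\Delta$. A polygonal path is standard if it is simple and its nonrepeated vertices are exactly the extreme vertices of its convex hull, each visited once; a hull edge not traversed by the path is a gap; a standard path is convex if its links follow one hull-boundary chain between its endpoints, nonconvex otherwise. $X\prec Y$ means $X$ is visited strictly before $Y$. Setting: $\gamma$ is a nonconvex standard polygonal escape path, length-minimal among polygonal escape paths with at most $N$ segments for some $N$, of length $L<D$. Its selected gap is a gap $FT$ with a hull vertex $M$ and $h>0$ such that, in suitable rigid coordinates, the hull $H=\operatorname{conv}\gamma$ lies in the strip $0\le y\le h$ (both boundary lines supporting it), $F=(x_F,0)$, $T=(x_T,0)$, $M=(x_M,h)$, $x_F\le x_T$, $F\prec M\prec T$, and $L\ge(1+\sqrt2)h$. The coordinates are translated horizontally so that the line $x=Ay$ supports $H$ with $H\subset\{x\ge Ay\}$.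 *)

(* Defs.v *)
From Stdlib Require Import Reals Lra List Rgeom.
From Coquelicot Require Import Coquelicot.
Import ListNotations.
Open Scope R_scope.

Definition rho : R := 301804 / 625565.
Definition coefA : R := 547947 / 301804.
Definition coefb : R := 197 / 766.
Definition Dbound : R := 82074390584 / 84861020075.

Lemma coefA_coefb : coefA + coefb = 1 / rho.
Proof. unfold coefA, coefb, rho. field. Qed.

Definition point : Type := (R * R)%type.
Definition region : Type := point -> Prop.

Definition image (f : point -> point) (K : region) : region :=
  fun q => exists p, K p /\ f p = q.

Definition interior (K : region) : region := fun p => locally p K.

Definition Delta : region :=
  fun p => 0 <= snd p /\ coefA * snd p <= fst p /\ fst p + coefb * snd p <= 1.

(** * Rigid motions *)

Definition translate (v p : point) : point := (fst p + fst v, snd p + snd v).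
Definition rotate (theta : R) (p : point) : point :=
  (cos theta * fst p - sin theta * snd p, sin theta * fst p + cos theta * snd p).
Definition reflect (p : point) : point := (fst p, - snd p).

(* Cartesian coordinate systems may have either orientation. *)
Definition rigid (Phi : point -> point) : Prop :=
  exists (theta : R) (v : point),
    (forall p, Phi p = translate v (rotate theta p)) \/
    (forall p, Phi p = translate v (rotate theta (reflect p))).

(** * Convexity in the plane *)

Definition lerp (t : R) (P Q : point) : point :=
  ((1 - t) * fst P + t * fst Q, (1 - t) * snd P + t * snd Q).

Definition segment (P Q : point) : region :=
  fun p => exists t, 0 <= t <= 1 /\ p = lerp t P Q.

Definition convex_region (K : region) : Prop :=
  forall P Q p, K P -> K Q -> segment P Q p -> K p.

Definition convex_hull (S : region) : region :=
  fun p => forall K, convex_region K -> (forall q, S q -> K q) -> K p.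

Definition extreme (K : region) (P : point) : Prop :=
  K P /\
  forall X Y t, K X -> K Y -> 0 < t < 1 -> P = lerp t X Y -> X = P /\ Y = P.

(* The line [u x + v y = c] supports [K], with [K] on the side
   [u x + v y >= c]. *)
Definition supports (u v c : R) (K : region) : Prop :=
  (u <> 0 \/ v <> 0) /\
  (forall p, K p -> c <= u * fst p + v * snd p) /\
  (exists p, K p /\ u * fst p + v * snd p = c).

Definition hull_edge (K : region) (P Q : point) : Prop :=
  P <> Q /\ extreme K P /\ extreme K Q /\
  exists u v c, supports u v c K /\
    u * fst P + v * snd P = c /\ u * fst Q + v * snd Q = c.

(** * Polygonal paths *)

(* A polygonal path is the list of points it joins successively by straight
   links.  Equal consecutive points are allowed; they only add links of length
   zero, which are discarded in [vertices] and [links]. *)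
Definition path : Type := list point.

Definition point_eq_dec (p q : point) : {p = q} + {p <> q}.
Proof. decide equality; apply Req_EM_T. Defined.

Fixpoint vertices (g : path) : list point :=
  match g with
  | p :: ((q :: _) as g') =>
      if point_eq_dec p q then vertices g' else p :: vertices g'
  | _ => g
  end.

Definition consecutive (s : list point) : list (point * point) :=
  combine s (tl s).

Definition links (g : path) : list (point * point) := consecutive (vertices g).

Definition segments (g : path) : nat := length (links g).

Definition path_length (g : path) : R :=
  fold_right Rplus 0
    (map (fun e => dist_euc (fst (fst e)) (snd (fst e))
                            (fst (snd e)) (snd (snd e))) (links g)).

Definition trace (g : path) : region :=
  fun p => In p g \/ exists P Q, In (P, Q) (links g) /\ segment P Q p.

Definition hull (g : path) : region := convex_hull (trace g).

Definition escape (g : path) : Prop :=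
  forall (theta : R) (v : point),
    ~ (forall p, trace g p -> interior Delta (translate v (rotate theta p))).

Definition is_minimizer (N : nat) (g : path) : Prop :=
  escape g /\ (segments g <= N)%nat /\
  forall g', escape g' -> (segments g' <= N)%nat ->
    path_length g <= path_length g'.

(* Two links share a point only if they are adjacent, and then only their
   common vertex. *)
Definition simple (g : path) : Prop :=
  forall i j P Q P' Q' p,
    (i < j)%nat ->
    nth_error (links g) i = Some (P, Q) ->
    nth_error (links g) j = Some (P', Q') ->
    segment P Q p -> segment P' Q' p ->
    j = S i /\ p = P'.

Definition standard (g : path) : Prop :=
  simple g /\ NoDup (vertices g) /\
  (forall p, In p (vertices g) <-> extreme (hull g) p).

(* A chain of the boundary of [K], given by the vertices it passes. *)
Definition boundary_chain (K : region) (s : list point) : Prop :=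
  NoDup s /\ forall P Q, In (P, Q) (consecutive s) -> hull_edge K P Q.

Definition convex_standard (g : path) : Prop :=
  standard g /\ boundary_chain (hull g) (vertices g).

Definition nonconvex_standard (g : path) : Prop :=
  standard g /\ ~ convex_standard g.

Definition gap (g : path) (P Q : point) : Prop :=
  hull_edge (hull g) P Q /\ ~ In (P, Q) (links g) /\ ~ In (Q, P) (links g).

Definition precedes (g : path) (X Y : point) : Prop :=
  exists l1 l2 l3, vertices g = l1 ++ X :: l2 ++ Y :: l3.

(* [F T] is a gap selected with hull vertex [M] and height [h], [Phi] mapping
   each point to its coordinates. *)
Definition selected_gap (g : path) (F M T : point) (h : R)
    (Phi : point -> point) : Prop :=
  gap g F T /\ extreme (hull g) M /\ 0 < h /\ rigid Phi /\
  supports 0 1 0 (image Phi (hull g)) /\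
  supports 0 (-1) (- h) (image Phi (hull g)) /\
  (exists xF xM xT, Phi F = (xF, 0) /\ Phi T = (xT, 0) /\ Phi M = (xM, h) /\
     xF <= xT) /\
  precedes g F M /\ precedes g M T /\
  (1 + sqrt 2) * h <= path_length g.

(* Main.v *)
From Stdlib Require Import Reals List Lra Psatz.
From Coquelicot Require Import Coquelicot.
Require Import Defs.
Open Scope R_scope.

(** Write [f] for the value of [x + b y] in the coordinates given by [Phi].
    The hull already satisfies the two other inequalities defining [Delta],
    namely [0 <= y] and [A y <= x], and the line [x = A y] touches it.  The
    claim is that the path meets the line [f = 1]; the bounds on the ordinate
    then come from the strip.  The path being connected, it could miss the line
    only by staying strictly on one side of it ([trace_meets_level]).

    If [f < 1] throughout, then [f <= 1 - d] for some [d > 0], since a path has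
    finitely many vertices.  This leaves room to push the path off the two
    sides [y = 0] and [x = A y] by a small translation, which places it in the
    interior of [Delta].  That contradicts the escape property, even if [Phi]
    reverses orientation, because the isosceles triangle [Delta] has a mirror
    symmetry ([escape_rigid]).

    If [f > 1] throughout, then [f > 1] on the hull.  At a hull point of the
    line [x = A y] one has [f = (A + b) y = y / rho], so [rho < y <= h], and
    [L >= (1 + sqrt 2) h > (1 + sqrt 2) rho], which exceeds [D]. *)

(** * Paths and affine functions *)

Definition affine (f : point -> R) : Prop :=
  forall t P Q, f (lerp t P Q) = (1 - t) * f P + t * f Q.

Lemma affine_le_convex (f : point -> R) (c : R) :
  affine f -> convex_region (fun p => f p <= c).
Proof. intros Hf P Q p HP HQ (t & Ht & ->). cbv beta in *. rewrite Hf. nra. Qed.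

Lemma affine_gt_convex (f : point -> R) (c : R) :
  affine f -> convex_region (fun p => c < f p).
Proof.
intros Hf P Q p HP HQ (t & Ht & ->). cbv beta in *. rewrite Hf.
(* One of the two weights is positive, which keeps the inequality strict. *)
destruct (Rle_lt_dec t (1 / 2)); nra.
Qed.

Lemma vertices_cons (p : point) (g : path) :
  exists s, vertices (p :: g) = p :: s.
Proof.
revert p; induction g as [|q g IH]; intros p.
- now exists nil.
- cbn [vertices]. destruct (point_eq_dec p q) as [->|_].
  + apply IH.
  + now exists (vertices (q :: g)).
Qed.

Lemma links_cons2 (p q : point) (g : path) :
  links (p :: q :: g) =
  if point_eq_dec p q then links (q :: g) else (p, q) :: links (q :: g).
Proof.
unfold links. cbn [vertices].
destruct (point_eq_dec p q); [reflexivity|].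
change (match g with
        | nil => q :: g
        | q0 :: _ => if point_eq_dec q q0 then vertices g else q :: vertices g
        end) with (vertices (q :: g)).
now destruct (vertices_cons q g) as [s ->].
Qed.

Lemma links_in (g : path) (P Q : point) :
  In (P, Q) (links g) -> In P g /\ In Q g.
Proof.
induction g as [|p [|q g] IH]; [easy | easy |].
rewrite links_cons2. destruct (point_eq_dec p q) as [_|_].
- intros H. destruct (IH H). split; now right.
- intros [[= <- <-]|H].
  + split; [now left | right; now left].
  + destruct (IH H). split; now right.
Qed.

Lemma trace_cons (p : point) (g : path) (r : point) :
  trace g r -> trace (p :: g) r.
Proof.
intros [H | (P & Q & H & HS)]; [left; now right |].
right; exists P, Q; split; [|exact HS].
destruct g as [|q g]; [easy|].
rewrite links_cons2. destruct (point_eq_dec p q); [exact H | now right].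
Qed.

Lemma first_segment_trace (p q : point) (g : path) (r : point) :
  segment p q r -> trace (p :: q :: g) r.
Proof.
intros H. destruct (point_eq_dec p q) as [Heq|Hneq].
- (* A repeated point gives no link, but then the segment is that point. *)
  left; left. destruct H as (t & _ & ->). subst q.
  destruct p as [x y]. unfold lerp; simpl. f_equal; ring.
- right; exists p, q; split; [|exact H].
  rewrite links_cons2. destruct (point_eq_dec p q); [easy | now left].
Qed.

Lemma trace_in_convex (K : region) (g : path) :
  convex_region K -> (forall p, In p g -> K p) -> forall p, trace g p -> K p.
Proof.
intros HK Hg p [H | (P & Q & H & HS)]; [now apply Hg |].
destruct (links_in g P Q H) as [HP HQ].
apply (HK P Q p); auto.
Qed.

Lemma trace_in_hull (g : path) (p : point) : trace g p -> hull g p.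
Proof. intros H K _ HK; now apply HK. Qed.

Lemma segment_meets_level (f : point -> R) (c : R) (P Q : point) :
  affine f -> (f P < c < f Q \/ f Q < c < f P) ->
  exists r, segment P Q r /\ f r = c.
Proof.
intros Hf H.
exists (lerp ((c - f P) / (f Q - f P)) P Q); split.
- exists ((c - f P) / (f Q - f P)); split; [|reflexivity].
  destruct H as [H|H].
  + split.
    * apply Rmult_le_pos; [lra | left; apply Rinv_0_lt_compat; lra].
    * apply Rle_div_l; lra.
  + replace ((c - f P) / (f Q - f P)) with ((f P - c) / (f P - f Q))
      by (field; lra).
    split.
    * apply Rmult_le_pos; [lra | left; apply Rinv_0_lt_compat; lra].
    * apply Rle_div_l; lra.
- rewrite Hf. field; lra.
Qed.

(** The intermediate value theorem for an affine function along a path, by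
    induction on the links: only the first link can join two vertices on
    different sides of the level. *)
Lemma trace_meets_level (f : point -> R) (c : R) (g : path) :
  affine f ->
  (forall p, In p g -> f p < c) \/ (forall p, In p g -> c < f p) \/
  (exists r, trace g r /\ f r = c).
Proof.
intros Hf; induction g as [|p g IH]; [now left|].
destruct (Req_dec (f p) c) as [Hp|Hp].
{ right; right; exists p; split; [left; now left | exact Hp]. }
destruct g as [|q g].
{ destruct (Rlt_le_dec (f p) c) as [Hlt|Hle].
  - left; intros r [<-|[]]; assumption.
  - right; left; intros r [<-|[]]; lra. }
assert (Hcross : (f p < c < f q \/ f q < c < f p) ->
                 exists r, trace (p :: q :: g) r /\ f r = c).
{ intros H. destruct (segment_meets_level f c p q Hf H) as (r & Hr & Hc).
  exists r; split; [now apply first_segment_trace | exact Hc]. }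
destruct IH as [IH | [IH | (r & Hr & Hc)]].
- assert (Hq := IH q (or_introl eq_refl)).
  destruct (Rlt_le_dec (f p) c) as [Hlt|Hle].
  + left; intros r [<-|H]; auto.
  + right; right; apply Hcross; right; lra.
- assert (Hq := IH q (or_introl eq_refl)).
  destruct (Rlt_le_dec (f p) c) as [Hlt|Hle].
  + right; right; apply Hcross; left; lra.
  + right; left; intros r [<-|H]; [lra | auto].
- right; right; exists r; split; [now apply trace_cons | exact Hc].
Qed.

Lemma finite_slack (f : point -> R) (c : R) (g : list point) :
  (forall p, In p g -> f p < c) ->
  exists d, 0 < d /\ forall p, In p g -> f p <= c - d.
Proof.
induction g as [|p g IH]; intros H.
- exists 1; split; [lra | easy].
- destruct IH as (d & Hd & Hg); [intros q Hq; apply H; now right |].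
  assert (Hp := H p (or_introl eq_refl)).
  exists (Rmin d (c - f p)); split; [apply Rmin_glb_lt; lra |].
  assert (H1 := Rmin_l d (c - f p)). assert (H2 := Rmin_r d (c - f p)).
  intros q [<-|Hq]; [lra |]. specialize (Hg q Hq). lra.
Qed.

(** * The triangle and its mirror symmetry *)

Definition open_Delta : region :=
  fun p => 0 < snd p /\ coefA * snd p < fst p /\ fst p + coefb * snd p < 1.

Lemma open_Delta_interior (p : point) : open_Delta p -> interior Delta p.
Proof.
destruct p as [x y]; intros (H1 & H2 & H3); simpl in *.
set (m := Rmin y (Rmin (x - coefA * y) (1 - (x + coefb * y)))).
assert (Hm : 0 < m) by (repeat apply Rmin_glb_lt; lra).
assert (M1 : m <= y) by apply Rmin_l.
assert (M2 : m <= x - coefA * y).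
{ eapply Rle_trans; [apply Rmin_r | apply Rmin_l]. }
assert (M3 : m <= 1 - (x + coefb * y)).
{ eapply Rle_trans; [apply Rmin_r | apply Rmin_r]. }
(* Moving each coordinate by less than [m/4] changes the three linear forms by
   less than [m], because [1 + A < 4]. *)
assert (Hm4 : 0 < m / 4) by lra.
exists (mkposreal _ Hm4). intros [x' y'] [Bx By]; simpl in Bx, By.
change (Rabs (x' - x) < m / 4) in Bx.
change (Rabs (y' - y) < m / 4) in By.
apply Rabs_def2 in Bx. apply Rabs_def2 in By.
clearbody m. unfold Delta, coefA, coefb in *; simpl. lra.
Qed.

Lemma rotate_translate_reflect (phi theta : R) (u p : point) :
  rotate phi (reflect (translate u (rotate theta (reflect p)))) =
  translate (rotate phi (reflect u)) (rotate (phi - theta) p).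
Proof.
destruct p as [x y], u as [a c].
unfold rotate, reflect, translate; simpl.
rewrite cos_minus, sin_minus. f_equal; ring.
Qed.

(** The apex of [Delta] is the origin, with equal sides along [(1, 0)] and
    along [(A rho, rho)], which is a unit vector.  The reflection exchanging
    these two directions is a mirror symmetry of [Delta]. *)
Lemma Delta_mirror :
  exists phi, forall p, open_Delta p -> open_Delta (rotate phi (reflect p)).
Proof.
exists (acos (coefA * rho)).
assert (Hc : cos (acos (coefA * rho)) = coefA * rho).
{ apply cos_acos. unfold coefA, rho. lra. }
assert (Hs : sin (acos (coefA * rho)) = rho).
{ rewrite sin_acos by (unfold coefA, rho; lra).
  apply sqrt_lem_1; unfold Rsqr, coefA, rho; lra. }
intros [x y]; unfold open_Delta, rotate, reflect; simpl.
rewrite Hc, Hs. unfold coefA, coefb, rho. lra.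
Qed.

Lemma escape_rigid (g : path) (Psi : point -> point) :
  escape g -> rigid Psi -> ~ (forall p, trace g p -> open_Delta (Psi p)).
Proof.
intros Hesc (theta & v & [HPsi|HPsi]) H.
- apply (Hesc theta v). intros p Hp.
  rewrite <- HPsi. now apply open_Delta_interior, H.
- destruct Delta_mirror as [phi Hphi].
  apply (Hesc (phi - theta) (rotate phi (reflect v))). intros p Hp.
  rewrite <- rotate_translate_reflect, <- HPsi.
  now apply open_Delta_interior, Hphi, H.
Qed.

Lemma rigid_translate (Phi : point -> point) (w : point) :
  rigid Phi -> rigid (fun p => translate w (Phi p)).
Proof.
intros (theta & v & H).
exists theta, (translate w v).
destruct H as [H|H]; [left | right]; intros p; rewrite H;
  unfold translate; simpl; f_equal; ring.
Qed.

Lemma rigid_linear_form_affine (Phi : point -> point) (u v : R) :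
  rigid Phi -> affine (fun p => u * fst (Phi p) + v * snd (Phi p)).
Proof.
intros (theta & w & [H|H]) t [x y] [x' y']; rewrite !H;
  unfold lerp, translate, rotate, reflect; simpl; ring.
Qed.

(** * Crossing the third side *)

(** A translation by [e (A + 1, 1)] adds [e] to both [y] and [x - A y], so for
    small [e > 0] it carries the path into the open triangle. *)
Lemma escape_not_below_third_side (g : path) (Phi : point -> point) :
  escape g -> rigid Phi ->
  (forall p, trace g p -> 0 <= snd (Phi p)) ->
  (forall p, trace g p -> coefA * snd (Phi p) <= fst (Phi p)) ->
  ~ (forall p, In p g -> 1 * fst (Phi p) + coefb * snd (Phi p) < 1).
Proof.
intros Hesc Hrig Hy Hx Hlt.
destruct (finite_slack _ _ _ Hlt) as (d & Hd & Hle).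
assert (Htr : forall p, trace g p ->
                1 * fst (Phi p) + coefb * snd (Phi p) <= 1 - d).
{ apply trace_in_convex; [|exact Hle].
  now apply affine_le_convex, rigid_linear_form_affine. }
(* The form [x + b y] grows by [e (A + 1 + b) < 4 e = d]. *)
apply (escape_rigid g
         (fun p => translate (d / 4 * (coefA + 1), d / 4) (Phi p)) Hesc).
{ now apply rigid_translate. }
intros p Hp.
specialize (Hy p Hp); specialize (Hx p Hp); specialize (Htr p Hp).
unfold open_Delta, translate, coefA, coefb in *; simpl. lra.
Qed.

Lemma Dbound_lt_strip_length (h : R) : rho < h -> Dbound < (1 + sqrt 2) * h.
Proof.
intros Hh.
assert (Hsqrt : 7 / 5 <= sqrt 2).
{ rewrite <- (sqrt_Rsqr (7 / 5)) by lra.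
  apply sqrt_le_1_alt. unfold Rsqr; lra. }
unfold rho, Dbound in *. nra.
Qed.

Theorem lemma4p1 (gamma : path) (F M T : point) (h : R) (Phi : point -> point)
    (Hstandard : nonconvex_standard gamma)
    (Hminimizer : exists N : nat, is_minimizer N gamma)
    (Hlength : path_length gamma < Dbound)
    (Hgap : selected_gap gamma F M T h Phi)
    (Hsupport : supports 1 (- coefA) 0 (image Phi (hull gamma))) :
  exists yD : R, 0 <= yD <= h /\
    image Phi (trace gamma) (1 - coefb * yD, yD).
Proof.
destruct Hminimizer as (N & Hesc & _).
destruct Hgap as (_ & _ & _ & Hrig & Hbot & Htop & _ & _ & _ & HL).
destruct Hbot as (_ & Hbot & _), Htop as (_ & Htop & _).
destruct Hsupport as (_ & Hside & (q' & (q & Hq & <-) & Hq0)).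
assert (Hbot' : forall p, hull gamma p -> 0 <= snd (Phi p)).
{ intros p Hp. specialize (Hbot (Phi p) (ex_intro _ p (conj Hp eq_refl))). lra. }
assert (Htop' : forall p, hull gamma p -> snd (Phi p) <= h).
{ intros p Hp. specialize (Htop (Phi p) (ex_intro _ p (conj Hp eq_refl))). lra. }
assert (Hside' : forall p, hull gamma p -> coefA * snd (Phi p) <= fst (Phi p)).
{ intros p Hp. specialize (Hside (Phi p) (ex_intro _ p (conj Hp eq_refl))). lra. }
assert (Haff := rigid_linear_form_affine Phi 1 coefb Hrig).
destruct (trace_meets_level _ 1 gamma Haff) as [Hlt | [Hgt | (r & Hr & Hr1)]].
- exfalso. refine (escape_not_below_third_side gamma Phi Hesc Hrig _ _ Hlt);
    auto using trace_in_hull.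
- exfalso.
  assert (Hq1 : 1 < 1 * fst (Phi q) + coefb * snd (Phi q)).
  { apply (Hq (fun p => 1 < 1 * fst (Phi p) + coefb * snd (Phi p))).
    - exact (affine_gt_convex _ 1 Haff).
    - apply trace_in_convex; [exact (affine_gt_convex _ 1 Haff) | exact Hgt]. }
  assert (Hrho : rho < h).
  { specialize (Htop' q Hq). unfold rho, coefA, coefb in *. lra. }
  assert (H := Dbound_lt_strip_length h Hrho). lra.
- exists (snd (Phi r)); split.
  + split; [apply Hbot' | apply Htop']; now apply trace_in_hull.
  + exists r; split; [exact Hr |].
    rewrite (surjective_pairing (Phi r)) at 1. f_equal. lra.
Qed.
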